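(* Let $\mathcal H_K$ be a reproducing kernel Hilbert space of complex-valued functions on a set $D$ with bounded kernel $K$, let $R:=\sup_{x\in D}\sqrt{K(x,x)}<\infty$, and let $n\in\mathbb N$ be such that $c_n:=c_n(B_{\mathcal H_K})_\infty>0$. Put $$m:=\bigl\lceil 4n\log_2(2+R/c_n)\bigr\rceil .$$ Then $$g_m^{\mathrm{lin}}(B_{\mathcal H_K})_\infty\le 16\,c_n(B_{\mathcal H_K})_\infty .$$
   Context: $B(D)$ is the space of bounded functions $D\to\mathbb C$ with norm $\|f\|_\infty=\sup_{x\in D}|f(x)|$. $\mathcal H_K$ is the reproducing kernel Hilbert space (RKHS) on $D$ with kernel $K\colon D\times D\to\mathbb C$, i.e. $f(x)=\langle f,K(\cdot,x)\rangle_{\mathcal H_K}$ for all $f\in\mathcal H_K$, $x\in D$. The kernel is bounded if $R<\infty$; then $\mathcal H_K$ embeds continuously into $B(D)$. $B_{\mathcal H_K}$ is the unit ball of $\mathcal H_K$. Gelfand widths: for $n\ge1$, $$c_n(B_{\mathcal H_K})_\infty:=\inf_{\psi,N}\ \sup_{f\in B_{\mathcal H_K}}\|f-\psi(Nf)\|_\infty,$$ the infimum over all bounded linear maps $N\colon\mathcal H_K\to\mathbb C^n$ and all (arbitrary, possibly non-linear) maps $\psi\colon\mathbb C^n\to B(D)$. Linear sampling widths: for $m\ge1$, $$g_m^{\mathrm{lin}}(B_{\mathcal H_K})_\infty:=\inf_{x_1,\dots,x_m\in D,\ \varphi}\ \sup_{f\in B_{\mathcal H_K}}\|f-\varphi(f(x_1),\dots,f(x_m))\|_\infty,$$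 the infimum over all points and all linear maps $\varphi\colon\mathbb C^m\to B(D)$. *)

(* Defs.v *)
From HB Require Import structures.
From mathcomp Require Import all_boot all_order all_algebra.
From mathcomp Require Export complex.
From mathcomp Require Import all_classical all_reals all_analysis.

Set Implicit Arguments.
Unset Strict Implicit.
Unset Printing Implicit Defensive.

Import Order.TTheory GRing.Theory Num.Theory.
Import numFieldNormedType.Exports.

Local Open Scope classical_set_scope.
Local Open Scope ring_scope.

(* The Hilbert space is an abstract complete normed space whose norm comes from
   the inner product [inner] (linear on the left, conjugate-linear on the
   right); [rkhs_eval] is an injective linear map that identifies its elements with
   functions on D. *)
Record rkhs (R : realType) (D : Type) (K : D -> D -> R[i]) := RKHS {
  rkhs_space :> completeNormedModType R[i];
  inner : {dot rkhs_space for Num.conj};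
  norm_inner : forall f : rkhs_space, `|f| ^+ 2 = inner f f;
  rkhs_eval : {linear rkhs_space -> (D -> R[i])};
  rkhs_eval_inj : injective rkhs_eval;
  kernel_section : D -> rkhs_space;
  kernel_sectionE : forall x y : D, rkhs_eval (kernel_section x) y = K y x;
  reproducing : forall (f : rkhs_space) (x : D), rkhs_eval f x = inner f (kernel_section x)
}.

Section Widths.
Variables (R : realType) (D : Type).
Implicit Type K : D -> D -> R[i].

(* For empty D these two suprema are -oo instead of 0; the Gelfand widths are
   then -oo, so positivity of a width still excludes this case. *)
Definition sup_norm (f : D -> R[i]) : \bar R :=
  ereal_sup [set (Normc.normc (f x))%:E | x in [set: D]].

(* K x x is real and nonnegative for the kernel of an RKHS *)
Definition kernel_radius K : \bar R :=
  ereal_sup [set (Num.sqrt (complex.Re (K x x)))%:E | x in [set: D]].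

(* f belongs to B(D) *)
Definition bounded_on (f : D -> R[i]) : Prop := (sup_norm f < +oo)%E.

Definition unit_ball K (H : rkhs K) : set H := [set f : H | `|f| <= 1].

Definition bounded_linear K (H : rkhs K) n (N : {linear H -> 'rV[R[i]]_n}) :
  Prop := exists M : R[i], forall f : H, `|N f| <= M * `|f|.

Definition worst_error K (H : rkhs K) (A : H -> (D -> R[i])) : \bar R :=
  ereal_sup [set sup_norm (rkhs_eval H f - A f) | f in @unit_ball K H].

Definition gelfand_width K (H : rkhs K) (n : nat) : \bar R :=
  ereal_inf [set e | exists (N : {linear H -> 'rV[R[i]]_n})
                            (psi : 'rV[R[i]]_n -> (D -> R[i])),
    [/\ bounded_linear N,
        forall v, bounded_on (psi v)
      & e = worst_error (fun f => psi (N f))]].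

Definition linear_sampling_width K (H : rkhs K) (m : nat) : \bar R :=
  ereal_inf [set e | exists (x : 'I_m -> D)
                            (phi : {linear 'rV[R[i]]_m -> (D -> R[i])}),
    (forall v, bounded_on (phi v)) /\
    e = worst_error (fun f => phi (\row_(i < m) rkhs_eval H f (x i)))].

End Widths.

Definition log2 (R : realType) (x : R) : R := ln x / ln 2.

(* the radius and the width are extended reals; both are finite whenever this
   number is used, and [fine] recovers their real values *)
Definition sample_count (R : realType) (D : Type) (K : D -> D -> R[i])
    (H : rkhs K) (n : nat) : nat :=
  `|Num.ceil (4 * n%:R *
      log2 (2 + fine (kernel_radius K) / fine (gelfand_width H n)))|%N.

(* Main.v *)
(* Since f(x) = <f, k_x>, sampling at points whose kernel sections span a space W
   and projecting onto W has worst-case uniform error sup_x dist(k_x, W).  If no m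
   points give error at most 16 c, a greedy choice yields k_{x_1}, ..., k_{x_m}
   whose successive Gram-Schmidt residuals all exceed 16 c, so that the triangular
   matrix of their coordinates in the resulting (Newton) basis has determinant
   larger than (16 c)^m.  On the other hand, an information map N with n
   components and error at most 2 c controls every k_x by 2 c on ker N.  In an
   orthonormal basis with all but n vectors in ker N, scaling the other n
   coordinates by about c / R makes every row O(c), and Hadamard's inequality
   bounds the determinant by (sqrt 5 c)^m (1 + R/c)^n.  For m >= 4 n log2 (2 + R/c)
   the two bounds contradict each other. *)
From HB Require Import structures.
Require Import Defs.
From mathcomp Require Import all_boot all_order all_algebra.
From mathcomp Require Import all_classical all_reals all_analysis.
From mathcomp Require Import ring lra.

Set Implicit Arguments.
Unset Strict Implicit.
Unset Printing Implicit Defensive.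

Import Order.TTheory GRing.Theory Num.Theory.

Local Open Scope ring_scope.
Local Open Scope sesquilinear_scope.

(** * Hadamard's inequality and unitary matrices adapted to a kernel *)

Section Unitary.
Variable C : numClosedFieldType.

(** Row [i] of [A] lies in the span of rows 0 to [i] of [schmidt A], and these are orthogonal to
    every later row. *)
Lemma mulmx_schmidt_trig n (A : 'M[C]_n) (i j : 'I_n) :
  (i < j)%N -> (A *m (schmidt A)^t*) i j = 0.
Proof.
move=> ltij; have /sub_sums_genmxP [u rowE] := row_schmidt_sub A i.
have -> : (A *m (schmidt A)^t*) i j = (row i A *m (schmidt A)^t*) 0 j.
  by rewrite -row_mul [RHS]mxE.
rewrite rowE mulmx_suml summxE big1 // => k leki.
have /unitarymxP UU := schmidt_unitarymx A (leqnn n).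
rewrite -mulmxA -row_mul UU mxE big_ord1 !mxE.
by rewrite -val_eqE (ltn_eqF (leq_ltn_trans leki ltij)) mulr0.
Qed.

Lemma sum_sqr_norm_row m n (A : 'M[C]_(m, n)) i :
  \sum_j `|A i j| ^+ 2 = (A *m A^t*) i i.
Proof. by rewrite mxE; apply: eq_bigr => j _; rewrite normCK !mxE. Qed.

Lemma normr_det_unitary n (U : 'M[C]_n) : U \is unitarymx -> `|\det U| = 1.
Proof.
move=> /unitarymxP /(congr1 determinant).
rewrite det_mulmx det_map_mx det_tr det1 -normCK => /eqP.
by rewrite sqrp_eq1 // => /eqP.
Qed.

(* Schmidt orthonormalization factors A as L U with U unitary and L lower
   triangular, and the rows of A and L have the same norms. *)
Lemma hadamard n (A : 'M[C]_n) :
  `|\det A| ^+ 2 <= \prod_i \sum_j `|A i j| ^+ 2.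
Proof.
have U_unit := schmidt_unitarymx A (leqnn n).
set U := schmidt A in U_unit; pose L := A *m U^t*.
have AE : A = L *m U by rewrite /L mulmxKtV.
have Ltrig : is_trig_mx L.
  by apply/is_trig_mxP => i j; exact: mulmx_schmidt_trig.
have -> : `|\det A| = `|\det L|.
  by rewrite {1}AE det_mulmx normrM (normr_det_unitary U_unit) mulr1.
rewrite det_trig // normr_prod -prodrXl; apply: ler_prod => i _.
rewrite exprn_ge0 //= sum_sqr_norm_row.
have -> : A *m A^t* = L *m L^t*.
  by rewrite {1 2}AE trmx_mul map_mxM mulmxA mulmxtVK.
rewrite -sum_sqr_norm_row (bigD1 i) //= lerDl.
by apply: sumr_ge0 => j _; exact: exprn_ge0.
Qed.

(** Orthonormalize the conjugated columns of [B], placed as the first [n] rows of a square matrix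
    padded with zero rows: every later row of the result is orthogonal to them, hence annihilates
    [B]. *)
Lemma unitary_kernel_rows m n (B : 'M[C]_(m, n)) : (n <= m)%N ->
  exists2 W : 'M[C]_m, W \is unitarymx &
    forall j : 'I_m, (n <= j)%N -> row j W *m B = 0.
Proof.
move=> lenm.
pose A : 'M[C]_m :=
  \matrix_(i, j) if insub (i : nat) is Some k then (B j k)^* else 0.
exists (schmidt A); first exact: schmidt_unitarymx.
move=> j lenj; apply/rowP => l; rewrite !mxE.
have /(congr1 Num.conj) :=
  mulmx_schmidt_trig A (i := widen_ord lenm l) (leq_trans (ltn_ord l) lenj).
rewrite mxE raddf_sum raddf0 /= => h; rewrite -[RHS]h; apply: eq_bigr => i _.
rewrite !mxE insubT //= => ll; rewrite rmorphM /= !conjCK mulrC.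
by congr (B _ _ * _); apply: val_inj.
Qed.

End Unitary.

(** * Orthonormal families, and a bound for determinants of coordinates *)

Section Orthonormal.
Variables (C : numClosedFieldType) (V : lmodType C) (dot : {dot V for Num.conj}).
Local Notation "''[' u , v ]" := (dot u%R v%R) : ring_scope.
Local Notation "''[' u ]" := '[u, u]%R : ring_scope.

Lemma dot_conj u v : '[u, v] = ('[v, u])^*.
Proof. by rewrite hermC mul1r. Qed.

Definition orthonormal_family m (e : 'I_m -> V) :=
  forall i j, '[e i, e j] = (i == j)%:R.

Section Projection.
Variables (m : nat) (e : 'I_m -> V).
Hypothesis e_on : orthonormal_family e.

Lemma orthonormal_coord (a : 'I_m -> C) (P : pred 'I_m) j :
  P j -> '[\sum_(i | P i) a i *: e i, e j] = a j.
Proof.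
move=> Pj; rewrite linear_sumlz (bigD1 j) //= linearZl_LR /= e_on eqxx mulr1.
rewrite big1 ?addr0 // => i /andP [_ /negPf neij].
by rewrite linearZl_LR /= e_on neij mulr0.
Qed.

Variables (P : pred 'I_m) (v : V).
Let p := \sum_(i | P i) '[v, e i] *: e i.

Lemma dot_projection : '[p, v] = \sum_(i | P i) `|'[v, e i]| ^+ 2.
Proof.
rewrite linear_sumlz; apply: eq_bigr => i _.
by rewrite linearZl_LR /= (dot_conj (e i)) normCK.
Qed.

Lemma dnorm_projection : '[p] = \sum_(i | P i) `|'[v, e i]| ^+ 2.
Proof.
rewrite {2}/p linear_sumr; apply: eq_bigr => i Pi.
by rewrite linearZr_LR /= orthonormal_coord // mulrC normCK.
Qed.

Lemma bessel : \sum_(i | P i) `|'[v, e i]| ^+ 2 <= '[v].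
Proof.
have := dnorm_ge0 dot (v - p).
rewrite dnormB -(dot_conj p) (dot_conj v p) dnorm_projection dot_projection.
rewrite geC0_conj; last by apply: sumr_ge0 => i _; exact: exprn_ge0.
by rewrite opprD addrA addrK subr_ge0.
Qed.

End Projection.

(** Bessel's inequality for the one-element family of the normalized [v]. *)
Lemma dot_cauchy_schwarz u v : `|'[u, v]| ^+ 2 <= '[u] * '[v].
Proof.
have [->|v0] := eqVneq v 0; first by rewrite !linear0r ?mulr0 normr0 expr0n.
have s0 : 0 < sqrtC '[v] by rewrite sqrt_dnorm_gt0.
pose e (_ : 'I_1) := (sqrtC '[v])^-1 *: v.
have e_on : orthonormal_family e.
  move=> i j; rewrite !ord1 eqxx dnormZ normfV (gtr0_norm s0) exprVn sqrtCK.
  by rewrite mulVf // dnorm_eq0.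
have := bessel e_on predT u; rewrite big_ord1 /e linearZr_LR /= normrM.
rewrite norm_conjC normfV (gtr0_norm s0) exprMn exprVn sqrtCK.
by rewrite mulrC ler_pdivrMr // dnorm_gt0.
Qed.

Lemma orthonormal_rotate m (W : 'M[C]_m) (e : 'I_m -> V) :
  W \is unitarymx -> orthonormal_family e ->
  orthonormal_family (fun j => \sum_l W j l *: e l).
Proof.
move=> /unitarymxP WW e_on i j.
rewrite linear_sumr /=; move/matrixP/(_ i j): WW; rewrite !mxE => <-.
apply: eq_bigr => l _.
by rewrite linearZr_LR /= (orthonormal_coord e_on) // !mxE mulrC.
Qed.

(* Rotate e so that all but n vectors of the new orthonormal basis lie in the
   kernel of N, where the coordinates of k i are controlled by eps; apply
   Hadamard's inequality after scaling the n other columns by s. *)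
Lemma det_coord_bound m n (e k : 'I_m -> V) (N : {linear V -> 'rV[C]_n})
    (rho eps s : C) :
  (n <= m)%N -> orthonormal_family e -> 0 <= eps -> 0 <= s ->
  (forall i, '[k i] <= rho) ->
  (forall f i, N f = 0 -> `|'[f, k i]| ^+ 2 <= eps * '[f]) ->
  s ^+ (2 * n) * `|\det (\matrix_(i, j) '[k i, e j])| ^+ 2 <=
    (s ^+ 2 * rho + eps) ^+ m.
Proof.
move=> lenm e_on eps0 s0 k_rho k_eps; set M := \matrix_(i, j) _.
have [W W_unit W_ker] :=
  unitary_kernel_rows (\matrix_(l < m) N (e l)) lenm.
pose e' j := \sum_l W j l *: e l.
have e'_on : orthonormal_family e' by exact: orthonormal_rotate.
have Ne' (j : 'I_m) : (n <= j)%N -> N (e' j) = 0.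
  move=> /W_ker <-; apply/rowP => c.
  rewrite linear_sum summxE !mxE; apply: eq_bigr => l _.
  by rewrite linearZ !mxE.
pose d : 'rV[C]_m := \row_j if (j < n)%N then s else 1.
have detd : \det (diag_mx d) = s ^+ n.
  rewrite det_diag (eq_bigr (fun j : 'I_m => if (j < n)%N then s else 1)).
    by rewrite -big_mkcond (big_ord_narrow lenm) prodr_const card_ord.
  by move=> j _; rewrite mxE.
have ME i j : (M *m W^t* *m diag_mx d) i j = '[k i, e' j] * d 0 j.
  rewrite mul_mx_diag mxE; congr (_ * _); rewrite mxE linear_sumr /=.
  by apply: eq_bigr => l _; rewrite linearZr_LR /= !mxE mulrC.
have -> : s ^+ (2 * n) * `|\det M| ^+ 2 =
    `|\det (M *m W^t* *m diag_mx d)| ^+ 2.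
  rewrite !det_mulmx detd !normrM !exprMn mulrC; congr (_ * _).
    have Wt : W^t* \is unitarymx by rewrite trmxC_unitary.
    by rewrite (normr_det_unitary Wt) expr1n mulr1.
  by rewrite normrX (ger0_norm s0) -exprM mulnC.
apply: le_trans (hadamard _) _.
rewrite -[X in _ ^+ X]card_ord -prodr_const; apply: ler_prod => i _.
apply/andP; split; first by apply: sumr_ge0 => j _; exact: exprn_ge0.
rewrite (bigID (fun j : 'I_m => (j < n)%N)) /=; apply: lerD.
  rewrite (eq_bigr (fun j => s ^+ 2 * `|'[k i, e' j]| ^+ 2)).
    rewrite -mulr_sumr ler_wpM2l ?exprn_ge0 //.
    exact: le_trans (bessel e'_on _ _) (k_rho i).
  by move=> j jn; rewrite ME mxE jn normrM (ger0_norm s0) exprMn mulrC.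
rewrite (eq_bigr (fun j => `|'[k i, e' j]| ^+ 2)); last first.
  by move=> j /negPf jn; rewrite ME mxE jn mulr1.
pose P (j : 'I_m) := ~~ (j < n)%N; set S := \sum_(_ | _) _.
have S0 : 0 <= S by apply: sumr_ge0 => j _; exact: exprn_ge0.
(* [q] is the projection of [k i] onto the part of the basis in the kernel of [N]. Both ['[q, k i]]
   and ['[q]] equal [S], so [k_eps] reads [S ^+ 2 <= eps * S], and [S] cancels unless it is 0. *)
pose q := \sum_(j | P j) '[k i, e' j] *: e' j.
have Nq : N q = 0.
  rewrite linear_sum big1 // => j; rewrite /P -leqNgt => jn.
  by rewrite linearZ /= Ne' ?scaler0.
have := k_eps q i Nq.
rewrite (dot_projection e' P) (dnorm_projection e'_on P) (ger0_norm S0) expr2.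
have [-> //|nzS] := eqVneq S 0.
by rewrite ler_pM2r // lt_def nzS.
Qed.

(** * Greedy choice of sampling points and the Newton basis *)

Section Greedy.
Variables (D : Type) (k : D -> V) (T : C).

Definition residual (e : nat -> V) J y :=
  k y - \sum_(i < J) '[k y, e i] *: e i.

(* e is the Gram-Schmidt basis of k (x 0), k (x 1), ..., so `|'[k (x i), e i]| is
   the distance from k (x i) to the span of its predecessors; the values of x and
   e at indices i >= J are irrelevant. *)
Definition newton_basis J (x : nat -> D) (e : nat -> V) :=
  [/\ orthonormal_family (fun i : 'I_J => e i),
      forall i, (i < J)%N ->
        k (x i) = \sum_(l < i.+1) '[k (x i), e l] *: e l
    & forall i, (i < J)%N -> T < `|'[k (x i), e i]| ^+ 2].

Lemma dot_residual (e : nat -> V) J y i :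
  orthonormal_family (fun i : 'I_J => e i) -> (i < J)%N ->
  '[residual e J y, e i] = 0.
Proof.
move=> e_on iJ; rewrite /residual linearBl.
have /= -> := orthonormal_coord e_on (fun l => '[k y, e l])
  (P := predT) (j := Ordinal iJ) isT.
by rewrite subrr.
Qed.

(** The normalized residual of [y] is appended to the basis. Its product with [k y] is the norm of
    the residual, so the new diagonal entry has square ['[r]], which exceeds [T]. *)
Lemma newton_basis_step J x e y : 0 <= T -> newton_basis J x e ->
  T < '[residual e J y] ->
  exists x' e', newton_basis J.+1 x' e'.
Proof.
move=> T0 [e_on kE kT] Tr; set r := residual e J y in Tr.
have r0 : 0 < '[r] by exact: le_lt_trans Tr.
have s0 : 0 < sqrtC '[r] by rewrite sqrtC_gt0.
pose eJ := (sqrtC '[r])^-1 *: r.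
pose e' i := if i == J then eJ else e i.
pose x' i := if i == J then y else x i.
have e'J : e' J = eJ by rewrite /e' eqxx.
have x'J : x' J = y by rewrite /x' eqxx.
have e'lt i : (i < J)%N -> e' i = e i by rewrite /e' => /ltn_eqF ->.
have x'lt i : (i < J)%N -> x' i = x i by rewrite /x' => /ltn_eqF ->.
have eJe i : (i < J)%N -> '[eJ, e i] = 0.
  by move=> iJ; rewrite linearZl_LR /= dot_residual // mulr0.
have eJ1 : '[eJ] = 1.
  rewrite dnormZ normfV (gtr0_norm s0) exprVn sqrtCK.
  by rewrite mulVf // lt0r_neq0.
have kyE : k y = sqrtC '[r] *: eJ + \sum_(i < J) '[k y, e i] *: e i.
  by rewrite /eJ scalerA divff ?lt0r_neq0 // scale1r subrK.
have kyeJ : '[k y, eJ] = sqrtC '[r].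
  rewrite kyE linearDl linear_sumlz /= big1 ?addr0 => [|i _].
    by rewrite linearZl_LR /= eJ1 mulr1.
  by rewrite linearZl_LR /= (dot_conj (e i)) eJe // conjC0 mulr0.
exists x', e'; split.
- move=> i j; rewrite -val_eqE /=.
  have := ltn_ord j; rewrite ltnS leq_eqVlt => /predU1P jJ.
  have := ltn_ord i; rewrite ltnS leq_eqVlt => /predU1P iJ.
  case: jJ => [->|jJ]; case: iJ => [->|iJ].
  + by rewrite e'J eqxx.
  + by rewrite e'J e'lt // (ltn_eqF iJ) dot_conj eJe // conjC0.
  + by rewrite e'J e'lt // (gtn_eqF jJ) eJe.
  + by rewrite !e'lt // (e_on (Ordinal iJ) (Ordinal jJ)).
- move=> i; rewrite ltnS leq_eqVlt => /predU1P [->|iJ].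
    rewrite x'J big_ord_recr /= e'J kyeJ addrC {1}kyE; congr (_ + _).
    by apply: eq_bigr => l _; rewrite e'lt.
  rewrite x'lt // {1}kE //; apply: eq_bigr => l _.
  by rewrite e'lt // (leq_trans (ltn_ord l)).
- move=> i; rewrite ltnS leq_eqVlt => /predU1P [->|iJ].
    by rewrite x'J e'J kyeJ (gtr0_norm s0) sqrtCK.
  by rewrite x'lt // e'lt // kT.
Qed.

Lemma newton_basis_greedy (x0 : D) m : 0 <= T ->
  (exists J x e, [/\ (J <= m)%N, newton_basis J x e
     & forall y, '[residual e J y] <= T]) \/
  (exists x e, newton_basis m x e).
Proof.
move=> T0; elim: m => [|m [[J [x [e [Jm nb H]]]]|[x [e nb]]]].
(* The empty basis: all values of [x] and [e] are irrelevant here, but [x] still needs some point of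
   [D]. *)
- by right; exists (fun=> x0), (fun=> 0); split => // -[].
- by left; exists J, x, e; split => //; exact: leqW.
have [H|/existsNP [y /negP]] :=
    pselect (forall y, '[residual e m y] <= T).
  by left; exists m, x, e; split.
(* The order of [C] is partial; the negation yields a strict inequality because both sides are
   real. *)
rewrite -real_ltNge ?ger0_real ?dnorm_ge0 // => H.
by right; exact: newton_basis_step T0 nb H.
Qed.

Lemma newton_basis_trig J x e (i j : nat) : newton_basis J x e ->
  (i < j)%N -> (j < J)%N -> '[k (x i), e j] = 0.
Proof.
move=> [e_on kE _] ij jJ; have iJ := ltn_trans ij jJ.
rewrite (kE i iJ) linear_sumlz big1 // => l _.
have li : (l < j)%N by rewrite (leq_trans (ltn_ord l)).
rewrite linearZl_LR /= (e_on (Ordinal (ltn_trans li jJ)) (Ordinal jJ)).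
by rewrite -val_eqE /= (ltn_eqF li) mulr0.
Qed.

Definition newton_mx J (x : nat -> D) (e : nat -> V) : 'M[C]_J :=
  \matrix_(i, j) '[k (x i), e j].

Lemma det_newton_mx J x e : newton_basis J x e ->
  \det (newton_mx J x e) = \prod_(i < J) '[k (x i), e i].
Proof.
move=> nb; rewrite det_trig; first by apply: eq_bigr => i _; rewrite mxE.
by apply/is_trig_mxP => i j ij; rewrite mxE (newton_basis_trig nb).
Qed.

(** This makes the coefficients of [f] along [e] computable from the samples of [f]. The triangular
    matrix is invertible because its diagonal entries have squared modulus above [T >= 0]. *)
Lemma newton_basis_span J x e : 0 <= T -> newton_basis J x e ->
  forall i : 'I_J,
    e i = \sum_(l < J) invmx (newton_mx J x e) i l *: k (x l).
Proof.
move=> T0 nb i; set M := newton_mx J x e; have [e_on kE kT] := nb.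
have M_unit : M \in unitmx.
  rewrite unitmxE unitfE det_newton_mx //; apply/prodf_neq0 => l _.
  have := le_lt_trans T0 (kT l (ltn_ord l)).
  by apply: contraTneq => ->; rewrite normr0 expr0n ltxx.
have kM l : k (x (l : 'I_J)) = \sum_j M l j *: e j.
  rewrite {1}kE // (big_ord_widen J (fun j => '[k (x l), e j] *: e j)) //.
  rewrite big_mkcond; apply: eq_bigr => j _; rewrite mxE.
  by case: ltnP => // lj; rewrite (newton_basis_trig nb) ?scale0r.
under eq_bigr do rewrite kM scaler_sumr.
rewrite exchange_big /= (bigD1 i) //=.
have MM j : \sum_l (invmx M i l *: (M l j *: e j)) = (i == j)%:R *: e j.
  under eq_bigr do rewrite scalerA.
  by rewrite -scaler_suml; have /matrixP/(_ i j) := mulVmx M_unit; rewrite !mxE => ->.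
rewrite MM eqxx scale1r big1 ?addr0 // => j /negPf ji.
by rewrite MM eq_sym ji scale0r.
Qed.

End Greedy.

End Orthonormal.

(** * Function values, kernel sections and sampling operators in the RKHS *)

Section Sampling.
Variables (R : realType) (D : Type) (K : D -> D -> R[i]) (H : rkhs K).
Local Open Scope complex_scope.
Local Notation dot := (inner H).
Local Notation eval := (rkhs_eval H).
Local Notation k := (kernel_section H).

Lemma normr_normc (z : R[i]) : `|z| = (Normc.normc z)%:C.
Proof. by case: z. Qed.

Lemma normc_ge0 (z : R[i]) : 0 <= Normc.normc z.
Proof. by rewrite -ler0c -normr_normc. Qed.

Lemma unit_ball_dot (f : H) : (@unit_ball _ _ _ H f) = (dot f f <= 1) :> Prop.
Proof. by rewrite /unit_ball /= -norm_inner expr_le1. Qed.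

Lemma sup_norm_le (f : D -> R[i]) (t : R) :
  (forall x, Normc.normc (f x) <= t) -> (sup_norm f <= t%:E)%E.
Proof. by move=> ft; apply: ge_ereal_sup => _ [x _ <-]; rewrite lee_fin. Qed.

Lemma worst_error_ge (A : H -> (D -> R[i])) (t : R) (f : H) x :
  (worst_error A <= t%:E)%E -> dot f f <= 1 ->
  Normc.normc (eval f x - A f x) <= t.
Proof.
rewrite -unit_ball_dot => At fB; rewrite -lee_fin; apply: le_trans At.
apply: (@le_trans _ _ (sup_norm (eval f - A f))).
  by apply: ereal_sup_ubound; exists x.
by apply: ereal_sup_ubound; exists f.
Qed.

(* f and -f have the same information 0, so the error is at least |f(x)|. *)
Lemma eval_le_of_worst_error n (N : {linear H -> 'rV[R[i]]_n})
    (psi : 'rV[R[i]]_n -> (D -> R[i])) (t : R) (f : H) x :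
  (worst_error (fun g => psi (N g)) <= t%:E)%E -> N f = 0 ->
  `|eval f x| ^+ 2 <= (t ^+ 2)%:C * dot f f.
Proof.
move=> Nt Nf0; have [->|f0] := eqVneq f 0.
  by rewrite linear0 normr0 expr0n linear0r mulr0.
have ff0 : 0 < dot f f by rewrite dnorm_gt0.
have s0 : 0 < sqrtC (dot f f) by rewrite sqrtC_gt0.
pose g := (sqrtC (dot f f))^-1 *: f.
have gg : dot g g = 1.
  rewrite dnormZ normfV (gtr0_norm s0) exprVn sqrtCK.
  by rewrite mulVf // lt0r_neq0.
have Ng : N g = 0 by rewrite linearZ /= Nf0 scaler0.
have gB : dot g g <= 1 by rewrite gg.
have h1 := worst_error_ge x Nt gB.
have : dot (- g) (- g) <= 1 by rewrite hnormN.
move=> /(worst_error_ge x Nt); rewrite !linearN Ng oppr0 /= => h2.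
move: h1; rewrite Ng => h1.
have gx : Normc.normc (eval g x) <= t.
  have := le_normcD (eval g x - psi 0 x) (- (- eval g x - psi 0 x)).
  rewrite normcN opprB addrA opprK subrK -mulr2n normcMn => h.
  by rewrite -(ler_pMn2r (n := 2)) // (le_trans h) // mulr2n lerD.
have -> : f = sqrtC (dot f f) *: g.
  by rewrite scalerA divff ?scale1r // lt0r_neq0.
rewrite linearZ /= normrM exprMn -/g dnormZ (gtr0_norm s0) sqrtCK gg mulr1.
rewrite mulrC; apply: ler_wpM2r; first exact: ltW.
rewrite normr_normc -rmorphXn lecR ler_pXn2r // nnegrE; first exact: normc_ge0.
exact: le_trans (normc_ge0 _) gx.
Qed.

Hypothesis hK : (kernel_radius K < +oo)%E.
Let r := fine (kernel_radius K).

(** The point [y] excludes the supremum -oo of the empty set, which [fine] would turn into 0. *)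
Lemma kernel_radius_fin (y : D) : kernel_radius K = r%:E.
Proof.
rewrite /r fineK // fin_numElt hK andbT.
apply: (@lt_le_trans _ _ (Num.sqrt (complex.Re (K y y)))%:E); first exact: ltNyr.
by apply: ereal_sup_ubound; exists y.
Qed.

Lemma sqrt_kernel_le (y : D) : Num.sqrt (complex.Re (K y y)) <= r.
Proof.
by rewrite -lee_fin -(kernel_radius_fin y); apply: ereal_sup_ubound; exists y.
Qed.

Lemma dot_kernel_le (y : D) : dot (k y) (k y) <= (r ^+ 2)%:C.
Proof.
have := dnorm_ge0 dot (k y).
rewrite -reproducing kernel_sectionE lecE /= => /andP [/eqP ImK ReK].
rewrite lecE ImK eqxx /= -(sqr_sqrtr ReK).
by rewrite ler_pXn2r ?nnegrE ?sqrtr_ge0 ?sqrt_kernel_le // (le_trans _ (sqrt_kernel_le y)).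
Qed.

Lemma eval_bounded (h : H) : bounded_on (eval h).
Proof.
pose B := complex.Re (dot h h * (r ^+ 2)%:C).
apply: (@le_lt_trans _ _ (Num.sqrt B)%:E); last exact: ltry.
apply: sup_norm_le => y.
have := dot_cauchy_schwarz dot h (k y).
rewrite -reproducing normr_normc -rmorphXn /= => hy.
have {hy} : (Normc.normc (eval h y) ^+ 2)%:C <= dot h h * (r ^+ 2)%:C.
  by apply: le_trans hy _; rewrite ler_wpM2l ?dnorm_ge0 ?dot_kernel_le.
rewrite lecE => /andP [_ /= hy].
by rewrite -(ger0_norm (normc_ge0 _)) -sqrtr_sqr ler_wsqrtr.
Qed.

(** The algorithm projects [f] orthogonally onto the span of [e]. Its error at [y] is the inner
    product of [f] with the residual of [k y], so Cauchy-Schwarz applies. Only the first [J] of the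
    [m] samples are used. *)
Lemma linear_sampling_width_le J m (x : nat -> D) (e : nat -> H) (t : R) :
  (J <= m)%N -> 0 <= t -> newton_basis dot k (t ^+ 2)%:C J x e ->
  (forall y, dot (residual dot k e J y) (residual dot k e J y) <= (t ^+ 2)%:C) ->
  (linear_sampling_width H m <= t%:E)%E.
Proof.
move=> Jm t0 nb et.
have T0 : 0 <= (t ^+ 2)%:C by rewrite ler0c exprn_ge0.
set A := invmx (newton_mx dot k J x e).
(* The coefficients are conjugated since [inner] is conjugate-linear on the right, where [e i] is
   expanded in kernel sections. *)
pose h (v : 'rV[R[i]]_m) : H :=
  \sum_(i < J) (\sum_(l < J) (A i l)^* * v 0 (widen_ord Jm l)) *: e i.
have h_linear : linear h.
  move=> a u v; rewrite /h scaler_sumr -big_split /=; apply: eq_bigr => i _.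
  rewrite scalerA -scalerDl mulr_sumr -big_split /=; congr (_ *: _).
  by apply: eq_bigr => l _; rewrite !mxE; ring.
pose hL := GRing.isLinear.Build _ _ _ _ h h_linear.
pose phi : {linear 'rV[R[i]]_m -> (D -> R[i])} :=
  eval \o (HB.pack_for {linear 'rV[R[i]]_m -> H} h hL).
apply: (@le_trans _ _ (worst_error
    (fun f : H => phi (\row_(i < m) eval f (x i))))).
  apply: ereal_inf_lbound; exists (fun i => x i), phi; split => // v.
  exact: eval_bounded.
apply: ge_ereal_sup => _ [f fB <-]; apply: sup_norm_le => y.
rewrite unit_ball_dot in fB.
have -> : (eval f - phi (\row_(i < m) eval f (x i))) y =
    dot f (residual dot k e J y).
  rewrite -[LHS]/(eval f y - eval (h (\row_(i < m) eval f (x i))) y).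
  rewrite !reproducing /residual linearBr /= linear_sumlz linear_sumr.
  congr (_ - _); apply: eq_bigr => i _.
  rewrite linearZl_LR linearZr_LR /= -dot_conj mulrC; congr (_ * _).
  rewrite {1}(newton_basis_span T0 nb i) linear_sumr.
  by apply: eq_bigr => l _; rewrite linearZr_LR /= mxE reproducing.
have : `|dot f (residual dot k e J y)| ^+ 2 <= (t ^+ 2)%:C.
  apply: le_trans (dot_cauchy_schwarz _ _ _) _.
  by rewrite -[leRHS]mul1r ler_pM ?dnorm_ge0.
rewrite normr_normc -rmorphXn lecR ler_pXn2r ?nnegrE //; exact: normc_ge0.
Qed.

End Sampling.

(** * The number of samples and the comparison of the determinant bounds *)

Lemma sample_count_bounds (R : realType) (n : nat) (a : R) : 0 <= a ->
  let m := `|Num.ceil (4 * n%:R * log2 (2 + a))|%N in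
  (4 * n <= m)%N /\ (1 + a) ^+ (4 * n) <= 2 ^+ m.
Proof.
move=> a0 m; have ln2 : 0 < ln 2 :> R by apply: ln_gt0; lra.
have lna : ln 2 <= ln (2 + a) by rewrite ler_ln ?posrE; lra.
(* The summand 2 inside the logarithm ensures [4 * n <= m] however small [a] is. *)
have L1 : 1 <= log2 (2 + a) by rewrite /log2 ler_pdivlMr // mul1r.
have n0 : 0 <= n%:R :> R by exact: ler0n.
have mL : 4 * n%:R * log2 (2 + a) <= m%:R.
  apply: le_trans (Num.Theory.ceil_ge _) _.
  by rewrite /m natr_absz ler_int ler_norm.
have nm : (4 * n)%:R <= m%:R :> R.
  by apply: le_trans mL; rewrite natrM ler_peMr // mulr_ge0.
split; first by rewrite -(ler_nat R).
apply: (@le_trans _ _ ((2 + a) ^+ (4 * n))).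
  by apply: lerXn2r; rewrite ?nnegrE; lra.
have p2 : 0 < 2 + a by lra.
rewrite -ler_ln ?posrE ?exprn_gt0 //.
rewrite !lnXn //.
rewrite -[leLHS]mulr_natl -[leRHS]mulr_natl natrM.
by rewrite -(ler_pdivrMr _ _ ln2); move: mL; rewrite /log2 mulrA.
Qed.

Lemma no_long_newton_basis (R : realType) (D : Type) (K : D -> D -> R[i])
    (H : rkhs K) (n m : nat) (c : R) (x : nat -> D) (e : nat -> H)
    (N : {linear H -> 'rV[R[i]]_n}) (psi : 'rV[R[i]]_n -> (D -> R[i])) :
  let r := fine (kernel_radius K) in
  (kernel_radius K < +oo)%E -> 0 < c -> (0 < n)%N ->
  (4 * n <= m)%N -> (1 + r / c) ^+ (4 * n) <= 2 ^+ m ->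
  (worst_error (fun f : H => psi (N f)) <= (2 * c)%:E)%E ->
  ~ newton_basis (inner H) (kernel_section H) (((16 * c) ^+ 2)%:C)%C m x e.
Proof.
move=> r hK c0 n0 nm rm NE nb.
have m0 : (0 < m)%N by apply: leq_trans nm; rewrite muln_gt0.
have r0 : 0 <= r := le_trans (sqrtr_ge0 _) (sqrt_kernel_le hK (x 0)).
(* The scale [s = c / (r + c)] brings the scaled coordinates down to size [c], by [s * r <= c],
   while its inverse is exactly the factor [1 + r / c] controlled by [m]. *)
have [s [s0 sc sr]] : exists s, [/\ 0 < s, s * (1 + r / c) = 1 & s * r <= c].
  have rc0 : 0 < r + c by rewrite ltr_wpDl.
  exists (c / (r + c)); split; first by rewrite divr_gt0.
    by field; rewrite !lt0r_neq0.
  by rewrite mulrAC ler_pdivrMr // ler_wpM2l ?(ltW c0) // lerDl ltW.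
have [e_on _ kT] := nb.
have := det_coord_bound (m := m) (n := n) (k := fun i => kernel_section H (x i))
  (N := N) (rho := ((r ^+ 2)%:C)%C) (eps := (((2 * c) ^+ 2)%:C)%C)
  (s := (s%:C)%C) (leq_trans (leq_pmull n (isT : 0 < 4)%N) nm) e_on.
rewrite !ler0c exprn_ge0 ?mulr_ge0 ?(ltW s0) ?(ltW c0) //.
move=> /(_ isT isT (fun i => dot_kernel_le H hK (x i))).
have kE (f : H) (i : 'I_m) : N f = 0 ->
    `|inner H f (kernel_section H (x i))| ^+ 2 <=
      (((2 * c) ^+ 2)%:C)%C * inner H f f.
  by rewrite -reproducing; exact: eval_le_of_worst_error NE.
move=> /(_ kE); rewrite -/(newton_mx _ _ m x e) (det_newton_mx nb).
rewrite normr_prod -prodrXl => le1.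
have le2 : ((((16 * c) ^+ 2) ^+ m)%:C)%C <=
    \prod_(i < m) `|inner H (kernel_section H (x i)) (e i)| ^+ 2.
  rewrite rmorphXn -[X in _ ^+ X]card_ord -prodr_const.
  apply: ler_prod => i _; rewrite ler0c exprn_ge0 ?mulr_ge0 ?(ltW c0) //=.
  exact: ltW (kT i (ltn_ord i)).
have {le1 le2} : s ^+ (2 * n) * ((16 * c) ^+ 2) ^+ m <=
    (s ^+ 2 * r ^+ 2 + (2 * c) ^+ 2) ^+ m.
  rewrite -lecR rmorphM [X in X * _]rmorphXn [leRHS]rmorphXn rmorphD rmorphM.
  rewrite [X in X * _ + _]rmorphXn.
  apply: le_trans le1; apply: ler_wpM2l le2.
  by rewrite exprn_ge0 // ler0c ltW.
set q := (1 + r / c) ^+ (2 * n).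
have q0 : 0 <= q by rewrite exprn_ge0 // addr_ge0 // divr_ge0 // ltW.
have sq : s ^+ (2 * n) * q = 1.
  by rewrite -exprMn sc expr1n.
have src : s ^+ 2 * r ^+ 2 + (2 * c) ^+ 2 <= 5 * c ^+ 2.
  have := mulr_ge0 (ltW s0) r0; nra.
have {src} src : (s ^+ 2 * r ^+ 2 + (2 * c) ^+ 2) ^+ m <= 5 ^+ m * (c ^+ 2) ^+ m.
  rewrite -[leRHS]exprMn; apply: lerXn2r src; rewrite nnegrE.
    by rewrite -exprMn addr_ge0 // sqr_ge0.
  by rewrite mulr_ge0 // sqr_ge0.
move=> /le_trans /(_ src).
rewrite (_ : (16 * c) ^+ 2 = 256 * c ^+ 2); last by ring.
rewrite exprMn mulrA ler_pM2r ?exprn_gt0 // => {}src.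
have {}src : 256 ^+ m <= 5 ^+ m * q.
  by have := ler_wpM2r q0 src; rewrite mulrAC sq mul1r.
(* Squaring turns [q] into [(1 + r / c) ^+ (4 * n)], which is at most [2 ^+ m]. *)
have : (256 ^+ m) ^+ 2 <= 5 ^+ m ^+ 2 * 2 ^+ m :> R.
  apply: (@le_trans _ _ ((5 ^+ m * q) ^+ 2)).
    apply: lerXn2r src; rewrite nnegrE; first by rewrite exprn_ge0.
    by rewrite mulr_ge0 // exprn_ge0.
  rewrite exprMn ler_wpM2l ?exprn_ge0 // /q -exprM.
  by rewrite (_ : (2 * n * 2 = 4 * n)%N) // mulnAC.
(* The inequality now compares m-th powers of [256 ^+ 2] and [5 ^+ 2 * 2 = 50]; it fails because [m]
   is positive. *)
rewrite ![_ ^+ m ^+ 2]exprAC -exprMn leNgt.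
by rewrite ltrXn2r ?exprn_ge0 ?mulr_ge0 // ?lt0n_neq0 //; lra.
Qed.

Theorem theorem2p5 (R : realType) (D : Type) (K : D -> D -> R[i]) (H : rkhs K)
    (n : nat)
    (hK : (kernel_radius K < +oo)%E)
    (hn : (0 < n)%N)
    (hc : (0 < gelfand_width H n)%E) :
  (linear_sampling_width H (sample_count H n) <= 16%:E * gelfand_width H n)%E.
Proof.
(* If the width is +oo, so is the right-hand side. *)
have [cfin|] := boolP (gelfand_width H n < +oo)%E; last first.
  rewrite -leNgt leye_eq => /eqP ->.
  by rewrite gt0_muley ?lte_fin // leey.
set c := fine (gelfand_width H n).
have cE : gelfand_width H n = c%:E.
  by rewrite /c fineK // gt0_fin_numE.
have c0 : 0 < c by rewrite -lte_fin -cE.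
(* The infimum need not be attained; the factor 2 provides an actual pair [N], [psi]. *)
have : (gelfand_width H n < (2 * c)%:E)%E by rewrite cE lte_fin; lra.
move=> /ereal_inf_lt [w [N [psi [N_bounded psi_bounded wE]]]].
rewrite {}wE => /ltW NE.
have cN : (c%:E <= worst_error (fun f : H => psi (N f)))%E.
  by rewrite -cE; apply: ereal_inf_lbound; exists N, psi.
(* For empty [D] every [sup_norm] is -oo, which contradicts [0 < c]. The point starts the greedy
   choice and shows [0 <= r]. *)
have [x0 _] : exists x : D, True.
  apply: contrapT => noD; move: cN; rewrite leNgt => /negP; apply.
  apply: (@le_lt_trans _ _ 0%E); last by rewrite lte_fin.
  apply: ge_ereal_sup => _ [f _ <-]; apply: ge_ereal_sup => _ [y _ <-].
  by case: noD; exists y.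
set m := sample_count H n.
set r := fine (kernel_radius K).
have r0 : 0 <= r := le_trans (sqrtr_ge0 _) (sqrt_kernel_le hK x0).
have [nm rm] := sample_count_bounds n (divr_ge0 r0 (ltW c0)).
have t0 : 0 <= 16 * c by rewrite mulr_ge0 // ltW.
rewrite cE -EFinM.
have T0 : 0 <= (((16 * c) ^+ 2)%:C)%C by rewrite ler0c exprn_ge0.
have [[J [x [e [Jm nb res]]]]|[x [e nb]]] :=
  newton_basis_greedy (inner H) (kernel_section H) x0 m T0.
  exact: linear_sampling_width_le nb res.
by case: (no_long_newton_basis hK c0 hn nm rm NE nb).
Qed.
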